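(* Let $F:\mathbb{R}^n\to\mathbb{R}^n$ be a single-valued $L$-Lipschitz operator ($L>0$), let $A:\mathbb{R}^n\rightrightarrows\mathbb{R}^n$ be a set-valued maximally monotone operator, and let $E=F+A$. Let $\rho\in\left(-\frac{1}{12\sqrt{3}L},0\right]$, and suppose $z^*\in\mathbb{R}^n$ satisfies $0\in E(z^* )$ and the weak Minty variational inequality $$\langle u,z-z^*\rangle\ge\rho\|u\|^2\quad\text{for all } z\in\mathbb{R}^n \text{ and } u\in E(z).$$ Then there exists $\eta\in(0,\frac{1}{2L})$ with $C:=\frac12+\frac{2\rho}{\eta}-2\eta^2L^2>0$. Moreover, for every such $\eta$, with corresponding $C$, and every starting point $z_0=z_{-\frac12}\in\mathbb{R}^n$, the iterates defined for $t=0,1,2,\dots$ by $$z_{t+\frac12}=J_{\eta A}\big[z_t-\eta F(z_{t-\frac12})\big],\qquad z_{t+1}=z_{t+\frac12}+\eta F(z_{t-\frac12})-\eta F(z_{t+\frac12})$$ (the Optimistic Gradient algorithm) satisfy, for every integer $T\ge1$, $$\min_{t\in\{1,\dots,T\}} r^{tan}_{F,A}(z_{t+\frac12})^2\ \le\ \min_{t\in\{1,\dots,T\}}\frac{\|z_{t+1}-z_t\|^2}{\eta^2}\ \le\ \frac{H^2}{C\eta^2}\cdot\frac1T,$$ where $H^2=\|z_1-z^*\|^2+\frac14\|z_{\frac12}-z_0\|^2$.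
   Context: $\langle\cdot,\cdot\rangle$ and $\|\cdot\|$ are the standard inner product and $\ell_2$-norm on $\mathbb{R}^n$. A set-valued operator $A:\mathbb{R}^n\rightrightarrows\mathbb{R}^n$ maps each point to a subset of $\mathbb{R}^n$; its graph is $\{(z,u):u\in A(z)\}$. $A$ is monotone if $\langle u-u',z-z'\rangle\ge0$ for all $(z,u),(z',u')$ in its graph, and maximally monotone if moreover its graph is not properly contained in the graph of another monotone operator. $E=F+A$ means $E(z)=\{F(z)+c:c\in A(z)\}$. The resolvent is $J_{\eta A}=(I+\eta A)^{-1}$, which is single-valued with domain $\mathbb{R}^n$ for $A$ maximally monotone and $\eta>0$. The tangent residual is $r^{tan}_{F,A}(z)=\min_{c\in A(z)}\|F(z)+c\|$. *)

(* Defs.v *)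
From HB Require Import structures.
From mathcomp Require Export all_boot all_order all_algebra.
From mathcomp Require Export boolp classical_sets reals.
Set Implicit Arguments.
Unset Strict Implicit.
Unset Printing Implicit Defensive.
Export Order.TTheory GRing.Theory Num.Theory.

Local Open Scope classical_set_scope.
Local Open Scope ring_scope.

(* Vectors of R^n are row vectors.  The library norm `|x| on matrices is the
   sup norm, hence the explicit Euclidean structure. *)
Definition dotv (R : realType) (n : nat) (u v : 'rV[R]_n) : R :=
  \sum_(i < n) u 0 i * v 0 i.

Definition norm2 (R : realType) (n : nat) (u : 'rV[R]_n) : R :=
  Num.sqrt (dotv u u).

Definition lipschitz2 (R : realType) (n : nat) (L : R)
    (F : 'rV[R]_n -> 'rV[R]_n) : Prop :=
  forall x y, norm2 (F x - F y) <= L * norm2 (x - y).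

(* A set-valued operator R^n => R^n; [A z u] reads "u \in A(z)". *)
Definition operator (R : realType) (n : nat) : Type :=
  'rV[R]_n -> set 'rV[R]_n.

Definition graph (R : realType) (n : nat) (A : operator R n) :
    set ('rV[R]_n * 'rV[R]_n) :=
  [set p | A p.1 p.2].

Definition monotone_op (R : realType) (n : nat) (A : operator R n) : Prop :=
  forall p q, graph A p -> graph A q -> 0 <= dotv (p.2 - q.2) (p.1 - q.1).

Definition maximally_monotone (R : realType) (n : nat) (A : operator R n) :
    Prop :=
  monotone_op A /\
  forall B : operator R n, monotone_op B -> ~ (graph A `<` graph B).

Definition op_add (R : realType) (n : nat) (F : 'rV[R]_n -> 'rV[R]_n)
    (A : operator R n) : operator R n :=
  fun z => [set F z + c | c in A z].

Definition op_scale (R : realType) (n : nat) (eta : R) (A : operator R n) :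
    operator R n :=
  fun z => [set eta *: c | c in A z].

Definition op_inv (R : realType) (n : nat) (A : operator R n) : operator R n :=
  fun u => [set z | A z u].

(* Kept set-valued; it is single-valued and everywhere defined when A is
   maximally monotone and eta > 0. *)
Definition resolvent (R : realType) (n : nat) (eta : R) (A : operator R n) :
    operator R n :=
  op_inv (op_add id (op_scale eta A)).

Definition is_min (R : realType) (S : set R) (m : R) : Prop :=
  S m /\ lbound S m.

Definition residuals (R : realType) (n : nat) (F : 'rV[R]_n -> 'rV[R]_n)
    (A : operator R n) (z : 'rV[R]_n) : set R :=
  [set norm2 (F z + c) | c in A z].

(* This is the minimum of the residuals as soon as they have one
   ([is_min]); [inf] has the junk value 0 on the empty set. *)
Definition tangent_residual (R : realType) (n : nat)
    (F : 'rV[R]_n -> 'rV[R]_n) (A : operator R n) (z : 'rV[R]_n) : R :=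
  inf (residuals F A z).

(* The minimum of f 1, ..., f T, for T >= 1; the seed f 1 is one of the
   terms. *)
Definition min_1_to (R : realType) (T : nat) (f : nat -> R) : R :=
  \big[Num.min/f 1%N]_(1 <= t < T.+1) f t.

(* z t is z_t, and zh t is z_{t - 1/2}; thus zh 0 is z_{-1/2} and zh t.+1 is
   z_{t + 1/2}. *)
Definition optimistic_gradient (R : realType) (n : nat)
    (F : 'rV[R]_n -> 'rV[R]_n) (A : operator R n) (eta : R) (z0 : 'rV[R]_n)
    (z zh : nat -> 'rV[R]_n) : Prop :=
  [/\ z 0%N = z0, zh 0%N = z0,
      forall t, resolvent eta A (z t - eta *: F (zh t)) (zh t.+1) &
      forall t, z t.+1 = zh t.+1 + eta *: F (zh t) - eta *: F (zh t.+1)].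

(* Main.v *)
Require Import Defs.
From mathcomp Require Import ring lra.
From mathcomp Require Import topology normedtype derive.
Set Implicit Arguments.
Unset Strict Implicit.
Unset Printing Implicit Defensive.
Import numFieldNormedType.Exports.
Local Open Scope classical_set_scope.
Local Open Scope ring_scope.

(** Write d_t = z_t - z_{t+1}, x = eta L and u_t = d_t / eta.

    The definition of the resolvent says that u_t = F(z_{t+1/2}) + c with c in
    A(z_{t+1/2}) ([optimistic_gradient_residual]).  So u_t lies in
    E(z_{t+1/2}): the tangent residual at z_{t+1/2} is at most |d_t| / eta,
    which is the first inequality, and u_t may be fed to the weak Minty
    inequality.  The latter bounds the cross term of the exact identity
    [dotv_energy], giving
      |z_{t+1} - z*|^2 <= |z_t - z*|^2 - (2 rho / eta) |d_t|^2
                          + |z_{t+1} - z_{t+1/2}|^2 - |z_t - z_{t+1/2}|^2.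

    The only bad term is the lag |z_{t+1} - z_{t+1/2}|^2.  By the Lipschitz
    bound it is at most x^2 |z_{t+1/2} - z_{t-1/2}|^2
    ([optimistic_gradient_lag]), hence at most
    2 x^2 (|z_t - z_{t+1/2}|^2 + |z_t - z_{t-1/2}|^2).  Weighting the lag by
    4 x^2 in the potential
      Phi_t = |z_t - z*|^2 + 4 x^2 |z_t - z_{t-1/2}|^2
    makes everything cancel and leaves
    Phi_{t+1} + C |d_t|^2 <= Phi_t ([potential_decrease]).  Summing over
    t = 1..T and bounding Phi_1 <= H^2 (here 4 x^2 <= 1 and the first lag is at
    most x^2 |z_{1/2} - z_0|^2) bounds T times the smallest |d_t|^2.

    For the residual to be a genuine minimum, A(z) has to be closed: by
    maximality it is an intersection of closed half-spaces
    ([maximally_monotone_closed]), and a closed nonempty set of R^n has a point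
    of least distance to any given point. *)

(** * Euclidean inner product *)

Lemma dotvv_ge0 (R : realType) (n : nat) (u : 'rV[R]_n) : 0 <= dotv u u.
Proof. by apply: sumr_ge0 => i _; exact: sqr_ge0. Qed.

Lemma norm2_sqr (R : realType) (n : nat) (u : 'rV[R]_n) :
  norm2 u ^+ 2 = dotv u u.
Proof. exact/sqr_sqrtr/dotvv_ge0. Qed.

Lemma dotvZl (R : realType) (n : nat) (a : R) (u v : 'rV[R]_n) :
  dotv (a *: u) v = a * dotv u v.
Proof. by rewrite /dotv mulr_sumr; apply: eq_bigr => i _; rewrite mxE mulrA. Qed.

Lemma dotvZZ (R : realType) (n : nat) (a : R) (u : 'rV[R]_n) :
  dotv (a *: u) (a *: u) = a ^+ 2 * dotv u u.
Proof.
by rewrite /dotv mulr_sumr; apply: eq_bigr => i _; rewrite !mxE; ring.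
Qed.

Lemma dotvNN (R : realType) (n : nat) (u v : 'rV[R]_n) :
  dotv (- u) (- v) = dotv u v.
Proof. by rewrite /dotv; apply: eq_bigr => i _; rewrite !mxE mulrNN. Qed.

Lemma dotv_sqrD_le (R : realType) (n : nat) (u v : 'rV[R]_n) :
  dotv (u + v) (u + v) <= 2 * dotv u u + 2 * dotv v v.
Proof.
rewrite /dotv !mulr_sumr -big_split; apply: ler_sum => i _ /=.
by rewrite !mxE; have := sqr_ge0 (u 0 i - v 0 i); nra.
Qed.

(** With z' the point after z and h the intermediate point, this expands
    |z' - s|^2 around z so that the cross term is taken at h, where the
    variational inequality holds, rather than at z. *)
Lemma dotv_energy (R : realType) (n : nat) (z h z' s : 'rV[R]_n) :
  dotv (z' - s) (z' - s) =
  dotv (z - s) (z - s) - 2 * dotv (z - z') (h - s)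
  + dotv (z' - h) (z' - h) - dotv (z - h) (z - h).
Proof.
rewrite /dotv mulr_sumr -!sumrN -!big_split; apply: eq_bigr => i _ /=.
by rewrite !mxE; ring.
Qed.

Lemma lipschitz2_sqr (R : realType) (n : nat) (L : R)
    (F : 'rV[R]_n -> 'rV[R]_n) (x y : 'rV[R]_n) :
  lipschitz2 L F ->
  dotv (F x - F y) (F x - F y) <= L ^+ 2 * dotv (x - y) (x - y).
Proof.
move=> FL; rewrite -!norm2_sqr -exprMn ler_sqr ?nnegrE ?sqrtr_ge0 //.
exact: le_trans (sqrtr_ge0 _) (FL x y).
Qed.

(** * Attainment of the tangent residual *)

(** A point (z, c) monotonically related to the whole graph could be adjoined
    to it, so maximality forces it to be there already. *)
Lemma maximally_monotone_mem (R : realType) (n : nat) (A : operator R n)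
    (z c : 'rV[R]_n) :
  maximally_monotone A ->
  (forall w v, A w v -> 0 <= dotv (c - v) (z - w)) -> A z c.
Proof.
move=> [Amono Amax] zc; apply: contrapT => nAzc.
pose B : operator R n := fun w v => A w v \/ (w = z /\ v = c).
have Bmono : monotone_op B.
  move=> [w v] [w' v'] [Awv|[/= -> ->]] [Awv'|[/= -> ->]] /=.
  - exact: (Amono (w, v) (w', v')).
  - by rewrite -dotvNN !opprB; exact: zc.
  - exact: zc.
  - by rewrite !subrr dotvv_ge0.
apply: (Amax B Bmono); split=> [[w v] Awv|BA]; first by left.
by apply: nAzc; apply: (BA (z, c)); right.
Qed.

Lemma continuous_dotv (R : realType) (n : nat) (T : topologicalType)
    (f g : T -> 'rV[R]_n) :
  continuous f -> continuous g -> continuous (fun x => dotv (f x) (g x)).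
Proof.
move=> cf cg; apply: continuous_big => [|i _]; first exact: add_continuous.
have coord (h : T -> 'rV[R]_n) : continuous h -> continuous (fun y => h y 0 i).
  move=> ch x; apply: (@continuous_comp _ _ _ h (fun v : 'rV[R]_n => v 0 i) x).
    exact: ch.
  exact: coord_continuous.
by move=> x; apply: cvgM; apply: coord.
Qed.

Lemma continuous_addr (R : realType) (n : nat) (a : 'rV[R]_n) :
  continuous (fun c : 'rV[R]_n => c + a).
Proof.
move=> y; apply: (@continuousD R _ 'rV[R]_n id (fun=> a) y); first exact: cvg_id.
exact: cst_continuous.
Qed.

(** By [maximally_monotone_mem], A(z) is the set of c satisfying the closed
    linear constraints <c - v, z - w> >= 0 for (w, v) in the graph. *)
Lemma maximally_monotone_closed (R : realType) (n : nat) (A : operator R n)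
    (z : 'rV[R]_n) : maximally_monotone A -> closed (A z).
Proof.
move=> Amax.
have -> : A z = \bigcap_(p in graph A)
    [set c | 0 <= dotv (c - p.2) (z - p.1)].
  apply/seteqP; split => [c Azc p Ap /=|c zc].
    exact: (Amax.1 (z, c)).
  by apply: maximally_monotone_mem => // w v Awv; exact: (zc (w, v)).
apply: closed_bigI => p _.
apply: (@preimage_closed _ _ (fun c : 'rV[R]_n => dotv (c - p.2) (z - p.1))
  [set x : R | 0 <= x]).
  move=> c _; apply: continuous_dotv => y; last exact: cst_continuous.
  exact: continuous_addr.
exact: closed_ge.
Qed.

(** Only the points of K at least as close to - a as some c0 in K compete;
    they form a closed subset of a box, hence a compact set. *)
Lemma closed_sqr_dist_min (R : realType) (n : nat) (K : set 'rV[R]_n)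
    (a : 'rV[R]_n) :
  closed K -> K !=set0 ->
  exists2 c, K c &
    forall c', K c' -> dotv (a + c) (a + c) <= dotv (a + c') (a + c').
Proof.
move=> Kcl [c0 Kc0].
pose q (c : 'rV[R]_n) := dotv (a + c) (a + c).
have cq : continuous q.
  have -> : q = fun c => dotv (c + a) (c + a).
    by apply/funext => c; rewrite /q addrC.
  by apply: continuous_dotv; exact: continuous_addr.
pose B := K `&` (q @^-1` [set x | x <= q c0]).
have Bcl : closed B.
  apply: closedI => //; apply: preimage_closed => [c _|]; first exact: cq.
  exact: closed_le.
pose b := Num.sqrt (q c0).
have Bcpt : compact B.
  apply: (@subclosed_compact _ _ [set v : 'rV[R]_n | forall i,
     `[- b - a 0 i, b - a 0 i]%classic (v ord0 i)]) => //.
    exact: (@rV_compact R n (fun i => `[- b - a 0 i, b - a 0 i]%classic))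
      (fun i => @segment_compact _ _ _).
  move=> c [_ /= qc] i; rewrite /= in_itv /=.
  have : `|a 0 i + c 0 i| <= b.
    rewrite -sqrtr_sqr; apply: ler_wsqrtr; apply: le_trans qc.
    rewrite /q /dotv (bigD1 i) //= !mxE -expr2 lerDl.
    by apply: sumr_ge0 => j _; exact: sqr_ge0.
  by rewrite ler_norml => /andP[h1 h2]; apply/andP; split; lra.
have B0 : B !=set0 by exists c0; split => //=.
have [c cB cmin] := EVT_min_rV B0 Bcpt (continuous_subspaceT cq).
move: cB; rewrite inE => -[Kc qc]; exists c => // c' Kc'.
have [qc'|/ltW qc'] := leP (q c') (q c0); last exact: le_trans qc qc'.
by apply: cmin; rewrite inE; split.
Qed.

Lemma inf_is_min (R : realType) (S : set R) (m : R) : is_min S m -> inf S = m.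
Proof.
move=> [Sm lbm]; apply/eqP; rewrite eq_le; apply/andP; split.
  by apply: ge_inf => //; exists m.
by apply: lb_le_inf => //; exists m.
Qed.

Lemma tangent_residual_is_min (R : realType) (n : nat)
    (F : 'rV[R]_n -> 'rV[R]_n) (A : operator R n) (z : 'rV[R]_n) :
  maximally_monotone A -> A z !=set0 ->
  is_min (residuals F A z) (tangent_residual F A z).
Proof.
move=> Amax Az0.
have [c Azc cmin] :=
  closed_sqr_dist_min (F z) (maximally_monotone_closed Amax) Az0.
have m : is_min (residuals F A z) (norm2 (F z + c)).
  split=> [|_ [c' Azc' <-]]; first by exists c.
  by apply: ler_wsqrtr; exact: cmin.
by rewrite /tangent_residual (inf_is_min m).
Qed.

(** * Minima over 1, ..., T *)

Lemma min_1_to_mono (R : realType) (T : nat) (f g : nat -> R) :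
  (forall t, f t <= g t) -> min_1_to T f <= min_1_to T g.
Proof.
move=> fg; rewrite /min_1_to; apply: (big_ind2 (fun x y => x <= y)) => //.
by move=> x1 x2 y1 y2 h1 h2; rewrite le_min !ge_min h1 h2 orbT.
Qed.

Lemma min_1_to_sum (R : realType) (T : nat) (f : nat -> R) :
  T%:R * min_1_to T f <= \sum_(1 <= t < T.+1) f t.
Proof.
have -> : T%:R * min_1_to T f = \sum_(1 <= t < T.+1) min_1_to T f.
  by rewrite sumr_const_nat subSS subn0 mulr_natl.
by apply: ler_sum_nat => t tT; apply: bigmin_inf_seq => //; rewrite mem_index_iota.
Qed.

(** * The step size *)

(** The choice eta L = 1 / (2 sqrt 3) gives 2 (eta L)^2 = 1/6, so C > 0 amounts
    to 2 rho / eta > - 1/3, which is the assumed bound on rho. *)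
Lemma exists_step_size (R : realType) (L rho : R) :
  0 < L -> - (1 / (12%:R * Num.sqrt 3%:R * L)) < rho ->
  exists eta : R, 0 < eta < 1 / (2%:R * L) /\
    0 < 1 / 2%:R + 2%:R * rho / eta - 2%:R * eta ^+ 2 * L ^+ 2.
Proof.
move=> L0 hrho; set s := Num.sqrt 3%:R in hrho *.
have s0 : 0 < s by rewrite sqrtr_gt0.
have s2 : s ^+ 2 = 3 by apply: sqr_sqrtr.
have s1 : 1 < s by nra.
exists (1 / (2 * s * L)); split.
  rewrite divr_gt0 ?mulr_gt0 //= ltr_pdivrMr ?mulr_gt0 // mul1r mulrC.
  rewrite ltr_pdivlMr ?mulr_gt0 //; nra.
have -> : 2%:R * (1 / (2 * s * L)) ^+ 2 * L ^+ 2 = 1 / 6 :> R.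
  have -> : 2%:R * (1 / (2 * s * L)) ^+ 2 * L ^+ 2 = 1 / (2 * s ^+ 2).
    by field; rewrite !gt_eqF.
  by rewrite s2; field.
have -> : 2%:R * rho / (1 / (2 * s * L)) = (12 * s * L * rho) / 3.
  by field; rewrite !gt_eqF.
have : - 1 < 12 * s * L * rho.
  have := hrho; rewrite -(@ltr_pM2l _ (12 * s * L)) ?mulr_gt0 //.
  by rewrite mulrN mul1r mulfV // gt_eqF // !mulr_gt0.
lra.
Qed.

(** * One step of the algorithm *)

(** The two F(z_{t-1/2}) terms of the updates cancel, leaving an implicit step
    along an element of E(z_{t+1/2}). *)
Lemma optimistic_gradient_residual (R : realType) (n : nat)
    (F : 'rV[R]_n -> 'rV[R]_n) (A : operator R n) (eta : R)
    (z0 : 'rV[R]_n) (z zh : nat -> 'rV[R]_n) (t : nat) :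
  0 < eta -> optimistic_gradient F A eta z0 z zh ->
  exists2 c, A (zh t.+1) c &
    z t - z t.+1 = eta *: (F (zh t.+1) + c).
Proof.
move=> eta0 [_ _ /(_ t)[_ [c Ac <-]] /= zhE /(_ t) zE].
exists c => //; apply/rowP => i; rewrite zE.
by move/rowP: zhE => /(_ i); rewrite !mxE; lra.
Qed.

(** The lag is eta times the difference of the two values of F that the
    correction step exchanges, so Lipschitz continuity controls it. *)
Lemma optimistic_gradient_lag (R : realType) (n : nat) (L : R)
    (F : 'rV[R]_n -> 'rV[R]_n) (A : operator R n) (eta : R)
    (z0 : 'rV[R]_n) (z zh : nat -> 'rV[R]_n) (t : nat) :
  lipschitz2 L F -> optimistic_gradient F A eta z0 z zh ->
  dotv (z t.+1 - zh t.+1) (z t.+1 - zh t.+1) <=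
  eta ^+ 2 * L ^+ 2 * dotv (zh t.+1 - zh t) (zh t.+1 - zh t).
Proof.
move=> FL [_ _ _ ->].
have -> : zh t.+1 + eta *: F (zh t) - eta *: F (zh t.+1) - zh t.+1 =
          - (eta *: (F (zh t.+1) - F (zh t))).
  by apply/rowP => i; rewrite !mxE; ring.
rewrite dotvNN dotvZZ -mulrA ler_wpM2l ?sqr_ge0 //.
exact: lipschitz2_sqr.
Qed.

(** Lyapunov function: h is the half iterate preceding z, and the term
    weighted by a pays for the lag that the next step will create. *)
Definition potential (R : realType) (n : nat) (a : R) (zs z h : 'rV[R]_n) : R :=
  dotv (z - zs) (z - zs) + a * dotv (z - h) (z - h).

(** With e, g, e' the squared lengths of z_t - z_{t-1/2}, z_t - z_{t+1/2} and
    z_{t+1} - z_{t+1/2}, and d that of z_{t+1} - z_t, the energy estimate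
    leaves a gain of g - e' besides - (2 rho / eta) d.  Since d <= 2 (g + e'),
    adding (1/2 - 2 x^2) d <= (1 - 4 x^2) (g + e') reduces the claim to
    2 e' <= 4 x^2 (g + e), which is the lag bound combined with
    |z_{t+1/2} - z_{t-1/2}|^2 <= 2 (g + e). *)
Lemma potential_decrease (R : realType) (n : nat) (L : R)
    (F : 'rV[R]_n -> 'rV[R]_n) (A : operator R n) (rho eta : R)
    (zs z0 : 'rV[R]_n) (z zh : nat -> 'rV[R]_n) (t : nat) :
  lipschitz2 L F ->
  (forall z u, op_add F A z u -> rho * norm2 u ^+ 2 <= dotv u (z - zs)) ->
  0 < eta -> eta ^+ 2 * L ^+ 2 <= 1 / 4 ->
  optimistic_gradient F A eta z0 z zh ->
  potential (4 * (eta ^+ 2 * L ^+ 2)) zs (z t.+1) (zh t.+1)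
  + (1 / 2%:R + 2%:R * rho / eta - 2%:R * eta ^+ 2 * L ^+ 2)
    * dotv (z t.+1 - z t) (z t.+1 - z t)
  <= potential (4 * (eta ^+ 2 * L ^+ 2)) zs (z t) (zh t).
Proof.
move=> FL minty eta0 small og; rewrite /potential.
have [c Ac dE] := optimistic_gradient_residual t eta0 og.
have lag := optimistic_gradient_lag t FL og.
have energy := dotv_energy (z t) (zh t.+1) (z t.+1) zs.
have inner : rho / eta * dotv (z t.+1 - z t) (z t.+1 - z t) <=
             dotv (z t - z t.+1) (zh t.+1 - zs).
  rewrite -dotvNN opprB dE dotvZZ dotvZl -norm2_sqr.
  have -> : rho / eta * (eta ^+ 2 * norm2 (F (zh t.+1) + c) ^+ 2) =
            eta * (rho * norm2 (F (zh t.+1) + c) ^+ 2).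
    by field; rewrite gt_eqF.
  by rewrite ler_pM2l //; apply: minty; exists c.
have young1 : dotv (zh t.+1 - zh t) (zh t.+1 - zh t) <=
    2 * dotv (z t - zh t.+1) (z t - zh t.+1) + 2 * dotv (z t - zh t) (z t - zh t).
  have -> : zh t.+1 - zh t = - (z t - zh t.+1) + (z t - zh t).
    by apply/rowP => i; rewrite !mxE; ring.
  by apply: le_trans (dotv_sqrD_le _ _) _; rewrite dotvNN.
have young2 : dotv (z t.+1 - z t) (z t.+1 - z t) <=
    2 * dotv (z t.+1 - zh t.+1) (z t.+1 - zh t.+1)
    + 2 * dotv (z t - zh t.+1) (z t - zh t.+1).
  have -> : z t.+1 - z t = (z t.+1 - zh t.+1) - (z t - zh t.+1).
    by apply/rowP => i; rewrite !mxE; ring.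
  by apply: le_trans (dotv_sqrD_le _ _) _; rewrite dotvNN.
move: lag energy inner young1 young2 small.
have -> : 2%:R * rho / eta = 2 * (rho / eta) by rewrite mulrA.
have -> : 2%:R * eta ^+ 2 * L ^+ 2 = 2 * (eta ^+ 2 * L ^+ 2) by rewrite mulrA.
have : 0 <= eta ^+ 2 * L ^+ 2 by rewrite mulr_ge0 ?sqr_ge0.
set x2 := eta ^+ 2 * L ^+ 2; set r := rho / eta.
set V' := dotv (_ - zs) _; set e' := dotv (_ - zh _) _.
set w := dotv (zh _ - _) _; set V := dotv (_ - zs) _.
set p := dotv (_ - _) (_ - zs); set g := dotv (z t - zh _) _.
set d := dotv (_ - z t) _; set e := dotv (_ - zh t) _.
move=> x20 lag energy inner young1 young2 small.
(* 1 / 2 - 2 * x2 is nonnegative because x2 <= 1 / 4. *)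
have h1 : (1 / 2 - 2 * x2) * d <= (1 / 2 - 2 * x2) * (2 * e' + 2 * g).
  by rewrite ler_wpM2l //; lra.
have h2 : x2 * w <= x2 * (2 * g + 2 * e) by rewrite ler_wpM2l.
lra.
Qed.

(** * Convergence of the algorithm *)

Theorem theorem1 (R : realType) (n : nat) (L : R) (F : 'rV[R]_n -> 'rV[R]_n)
    (A : operator R n) (rho : R) (zs : 'rV[R]_n) :
  0 < L ->
  lipschitz2 L F ->
  maximally_monotone A ->
  - (1 / (12%:R * Num.sqrt 3%:R * L)) < rho <= 0 ->
  op_add F A zs 0 ->
  (forall z u, op_add F A z u -> rho * norm2 u ^+ 2 <= dotv u (z - zs)) ->
  let C (eta : R) : R :=
    1 / 2%:R + 2%:R * rho / eta - 2%:R * eta ^+ 2 * L ^+ 2 in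
  (exists eta : R, 0 < eta < 1 / (2%:R * L) /\ 0 < C eta) /\
  (forall eta : R, 0 < eta < 1 / (2%:R * L) -> 0 < C eta ->
   forall (z0 : 'rV[R]_n) (z zh : nat -> 'rV[R]_n),
   optimistic_gradient F A eta z0 z zh ->
   let H2 : R := norm2 (z 1%N - zs) ^+ 2
             + 1 / 4%:R * norm2 (zh 1%N - z 0%N) ^+ 2 in
   (forall t, is_min (residuals F A (zh t.+1))
                     (tangent_residual F A (zh t.+1))) /\
   (forall T : nat, (1 <= T)%N ->
    min_1_to T (fun t => tangent_residual F A (zh t.+1) ^+ 2)
      <= min_1_to T (fun t => norm2 (z t.+1 - z t) ^+ 2 / eta ^+ 2)
      <= H2 / (C eta * eta ^+ 2) * (1 / T%:R))).
Proof.
move=> L0 FL Amax /andP[hrho _] _ minty C; split.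
  exact: exists_step_size.
move=> eta /andP[eta0 etaL] C0 z0 z zh og H2.
have resmin t : is_min (residuals F A (zh t.+1)) (tangent_residual F A (zh t.+1)).
  have [c Ac _] := optimistic_gradient_residual t eta0 og.
  by apply: tangent_residual_is_min => //; exists c.
split=> // T T1; apply/andP; split.
  apply: min_1_to_mono => t.
  have [c Ac dE] := optimistic_gradient_residual t eta0 og.
  have [[c' _ rE] lb] := resmin t.
  have -> : norm2 (z t.+1 - z t) ^+ 2 / eta ^+ 2 = norm2 (F (zh t.+1) + c) ^+ 2.
    rewrite !norm2_sqr -dotvNN opprB dE dotvZZ mulrC mulKf //.
    by rewrite expf_neq0 // gt_eqF.
  rewrite ler_sqr ?nnegrE -?rE ?sqrtr_ge0 // rE.
  by apply: lb; exists c.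
have small : eta ^+ 2 * L ^+ 2 <= 1 / 4.
  have : eta * L < 1 / 2.
    move: etaL; rewrite ltr_pdivlMr ?mulr_gt0 //; lra.
  have : 0 < eta * L by rewrite mulr_gt0.
  rewrite -exprMn; nra.
pose Phi t := potential (4 * (eta ^+ 2 * L ^+ 2)) zs (z t) (zh t).
pose d t := dotv (z t.+1 - z t) (z t.+1 - z t).
have a0 : 0 <= 4 * (eta ^+ 2 * L ^+ 2) by rewrite mulr_ge0 // mulr_ge0 ?sqr_ge0.
have Phi0 t : 0 <= Phi t by rewrite addr_ge0 ?dotvv_ge0 // mulr_ge0 ?dotvv_ge0.
have Phi1 : Phi 1%N <= H2.
  rewrite /Phi /potential /H2 !norm2_sqr lerD2l.
  (* z_0 = z_{-1/2}, so the first lag is measured against z_{1/2} - z_0. *)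
  have := optimistic_gradient_lag 0 FL og.
  have -> : zh 0%N = z 0%N by case: og => -> ->.
  move: a0 small; set x2 := eta ^+ 2 * L ^+ 2 => a0 small lag.
  have := dotvv_ge0 (z 1%N - zh 1%N); have := dotvv_ge0 (zh 1%N - z 0%N).
  nra.
have sumd : C eta * \sum_(1 <= t < T.+1) d t <= H2.
  have telescope : C eta * \sum_(1 <= t < T.+1) d t <= Phi 1%N - Phi T.+1.
    rewrite -(opprB (Phi T.+1)) -(telescope_sumr Phi) // mulr_sumr -sumrN.
    apply: ler_sum => t _; rewrite opprB lerBrDl.
    exact: potential_decrease minty eta0 small og.
  by have := Phi0 T.+1; lra.
have T0 : (0 : R) < T%:R by rewrite ltr0n.
have -> : H2 / (C eta * eta ^+ 2) * (1 / T%:R) = H2 / (C eta * eta ^+ 2) / T%:R.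
  by rewrite mul1r.
rewrite ler_pdivlMr // [X in X <= _]mulrC.
apply: le_trans (min_1_to_sum _ _) _.
rewrite -mulr_suml (eq_bigr d) => [|t _]; last exact: norm2_sqr.
rewrite [(C eta * _)^-1]invfM mulrA ler_pM2r ?invr_gt0 ?exprn_gt0 //.
by rewrite ler_pdivlMr // mulrC.
Qed.
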